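(* Let $r=c=1$, $T\in(0,\infty)$, and let $(Y^i)_{i\ge1}$ be i.i.d. processes such that $Y^i_t=Y^i_0$ for $0\le t<T$ with $\mathrm{Law}(Y^i_t)=\frac12\delta_{1/2}+\frac12\delta_2$ for all $0\le t<T$, and $Y^i_t=2$ for $t\ge T$. Let $\rho^m(t)$ be the minimal solution $u\in[0,1]$ of $u+F_t(1-u)=1$, so that $\rho^m(t)=\frac12$ for $0\le t<T$. Then, for any $0\le t<T$, $\rho^m(t)$ is not a weak accumulation point of $n$-player equilibria; that is, there are no subsequence $(n_k)$ with $n_k\to\infty$ and $n_k$-player equilibria $\rho_{n_k}$ such that $\rho_{n_k}(t)$ converges weakly (in law) to the constant $\rho^m(t)=\frac12$.
   Context: $(\Omega,\mathcal{G},P)$ is a probability space with a right-continuous filtration $\mathbb{G}=(\mathcal{G}_t)_{t\ge0}$ with respect to which the $Y^i$ are progressively measurable; $F_t(y)=P\{Y^i_t\le y\}$. In the $n$-player game (here with $r=c=1$) the players are $1,\dots,n$ with signals $Y^1,\dots,Y^n$. An $n$-player equilibrium is a $\mathbb{G}$-adapted process $\rho_n$ of the form $\rho_n(t)=\#\{j\le n:\tau^j\le t\}/n$, where $\tau^1,\dots,\tau^n$ are $\mathbb{G}$-stopping times with $\tau^i=\inf\{t\ge0:\ Y^i_t+c\rho_n^{-i}(t)\ge r\}$ and $\rho_n^{-i}(t)=\#\{j\ne i:\tau^j\le t\}/n$. *)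

(* Defs.v *)
From HB Require Import structures.
From mathcomp Require Import all_boot all_order all_algebra finmap.
From mathcomp Require Import all_classical all_reals all_analysis.

Set Implicit Arguments.
Unset Strict Implicit.
Unset Printing Implicit Defensive.

Import Order.TTheory GRing.Theory Num.Theory.
Import numFieldNormedType.Exports.

Local Open Scope classical_set_scope.
Local Open Scope ring_scope.

(* The time set is [0, oo[, represented by the t : R with 0 <= t; the values of
   filtrations and processes at negative times are never used. Players and
   signals are numbered from 0, so Y 0, Y 1, ... stand for Y^1, Y^2, ... *)

Definition filtration d (Omega : measurableType d) (R : realType)
    (G : R -> set (set Omega)) : Prop :=
  [/\ forall t : R, 0 <= t -> sigma_algebra setT (G t),
      forall t : R, 0 <= t -> G t `<=` measurable
    & forall s t : R, 0 <= s -> s <= t -> G s `<=` G t].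

Definition right_continuous_filtration d (Omega : measurableType d)
    (R : realType) (G : R -> set (set Omega)) : Prop :=
  forall t : R, 0 <= t -> G t = \bigcap_(s in [set s : R | t < s]) G s.

Definition adapted d (Omega : measurableType d) (R : realType)
    (G : R -> set (set Omega)) (X : R -> Omega -> R) : Prop :=
  forall t : R, 0 <= t ->
    @measurable_fun _ _ (g_sigma_algebraType (G t)) R setT (X t).

Definition progressively_measurable d (Omega : measurableType d)
    (R : realType) (G : R -> set (set Omega)) (X : R -> Omega -> R) : Prop :=
  forall t : R, 0 <= t ->
    @measurable_fun _ _ (measurableTypeR R * g_sigma_algebraType (G t))%type R
      [set p | 0 <= p.1 <= t] (fun p => X p.1 p.2).

(* Stopping times may take the value +oo. *)
Definition stopping_time d (Omega : measurableType d) (R : realType)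
    (G : R -> set (set Omega)) (tau : Omega -> \bar R) : Prop :=
  (forall w, (0 <= tau w)%E) /\
  (forall t : R, 0 <= t -> G t [set w | (tau w <= t%:E)%E]).

(* The product sigma-algebra on the space of paths, generated by the
   coordinate maps at nonnegative times. *)
Definition cylinder_sigma_algebra (R : realType) : set (set (R -> R)) :=
  <<s [set C | exists (t : R) (B : set R),
         [/\ 0 <= t, measurable B & C = [set x | B (x t)]] ] >>.

Definition path_event d (Omega : measurableType d) (R : realType)
    (X : R -> Omega -> R) (C : set (R -> R)) : set Omega :=
  [set w | C (X ^~ w)].

Definition independent_processes d (Omega : measurableType d) (R : realType)
    (P : probability Omega R) (Y : nat -> R -> Omega -> R) : Prop :=
  forall (J : {fset nat}) (C : nat -> set (R -> R)),
    (forall i, i \in J -> cylinder_sigma_algebra (C i)) ->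
    P (\bigcap_(i in [set` J]) path_event (Y i) (C i)) =
      (\prod_(i <- J) P (path_event (Y i) (C i)))%E.

Definition identically_distributed_processes d (Omega : measurableType d)
    (R : realType) (P : probability Omega R) (Y : nat -> R -> Omega -> R)
    : Prop :=
  forall i j (C : set (R -> R)), cylinder_sigma_algebra C ->
    P (path_event (Y i) C) = P (path_event (Y j) C).

Definition iid_processes d (Omega : measurableType d) (R : realType)
    (P : probability Omega R) (Y : nat -> R -> Omega -> R) : Prop :=
  independent_processes P Y /\ identically_distributed_processes P Y.

Definition proportion_stopped d (Omega : measurableType d) (R : realType)
    (n : nat) (tau : 'I_n -> Omega -> \bar R) (t : R) (w : Omega) : R :=
  #|[pred j | (tau j w <= t%:E)%E]|%:R / n%:R.

Definition proportion_others_stopped d (Omega : measurableType d)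
    (R : realType) (n : nat) (tau : 'I_n -> Omega -> \bar R) (i : 'I_n)
    (t : R) (w : Omega) : R :=
  #|[pred j | (j != i) && (tau j w <= t%:E)%E]|%:R / n%:R.

Definition player_equilibrium d (Omega : measurableType d) (R : realType)
    (G : R -> set (set Omega)) (Y : nat -> R -> Omega -> R) (r c : R)
    (n : nat) (rho : R -> Omega -> R) : Prop :=
  adapted G rho /\
  exists tau : 'I_n -> Omega -> \bar R,
    [/\ forall i, stopping_time G (tau i),
        forall i w, tau i w =
          ereal_inf [set t%:E | t in
            [set t : R | 0 <= t /\
               r <= Y i t w + c * proportion_others_stopped tau i t w]]
      & forall (t : R) w, 0 <= t -> rho t w = proportion_stopped tau t w].

(* Here X is the signal at a fixed time, with distribution function cdf X. *)
Definition mean_field_solution d (Omega : measurableType d) (R : realType)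
    (P : probability Omega R) (r c : R) (X : {RV P >-> R}) (u : R) : Prop :=
  0 <= u <= 1 /\ (u%:E + cdf X (r - c * u) = 1)%E.

Definition minimal_solution d (Omega : measurableType d) (R : realType)
    (P : probability Omega R) (r c : R) (X : {RV P >-> R}) (u : R) : Prop :=
  mean_field_solution r c X u /\
  forall v, mean_field_solution r c X v -> u <= v.

(* The default value 0 of xget is taken only if no minimal solution exists.
   For i.i.d. signals the index 0 could be replaced by any other. *)
Definition rho_min d (Omega : measurableType d) (R : realType)
    (P : probability Omega R) (r c : R) (Y : nat -> R -> {RV P >-> R}) (t : R)
    : R :=
  xget 0 [set u | minimal_solution r c (Y 0%N t) u].

Definition converges_in_law d (Omega : measurableType d) (R : realType)
    (P : probability Omega R) (X_ : nat -> Omega -> R) (X : Omega -> R)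
    : Prop :=
  forall f : R -> R, continuous f -> bounded_fun f ->
    ('E_P[f \o X_ k])%E @[k --> \oo] --> ('E_P[f \o X])%E.

Definition weak_accumulation_point_of_equilibria d (Omega : measurableType d)
    (R : realType) (P : probability Omega R) (G : R -> set (set Omega))
    (Y : nat -> R -> Omega -> R) (r c t x : R) : Prop :=
  exists (n_ : nat -> nat) (rho_ : nat -> R -> Omega -> R),
    [/\ n_ k @[k --> \oo] --> \oo,
        forall k, player_equilibrium G Y r c (n_ k) (rho_ k)
      & converges_in_law P (fun k => rho_ k t) (cst x)].

(* Main.v *)
Require Import Defs.
From HB Require Import structures.
From mathcomp Require Import all_boot all_order all_algebra.
From mathcomp Require Import finmap lra zify.
From mathcomp Require Import all_classical all_reals all_analysis.
From mathcomp Require Import measurable_realfun.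

(** With 1 - u in [0, 1], the distribution function of the signal before T
    takes there only the values 0 (below 1/2) and 1/2, so u + F(1 - u) = 1 has
    the two solutions u = 1/2 and u = 1, and the minimal one is 1/2.

    Finite games jump past this solution with probability at least 1/2. A
    player whose signal is 2 stops at time 0 whatever the others do. If at least
    half of the n players are such, then each of the remaining players, whose
    signals are 1/2, already sees a proportion at least 1/2 of the others
    stopped at time 0, hence stops at time 0 too: the equilibrium is
    identically 1 ([player_equilibrium_all_stopped]). The number of signals
    equal to 2 is a symmetric binomial variable, and by the symmetry exchanging
    2 and 1/2 it is at least n/2 with probability at least 1/2
    ([half_le_prob_majority]). So every n-player equilibrium with n > 0 gives
    the value 1 a mass at least 1/2, at every time, and a weak limit that is
    constant can only be 1 ([converges_in_law_cst_atom]). *)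

Set Implicit Arguments.
Unset Strict Implicit.
Unset Printing Implicit Defensive.

Import Order.TTheory GRing.Theory Num.Theory.
Import numFieldNormedType.Exports.

Local Open Scope classical_set_scope.
Local Open Scope ring_scope.

Lemma adapted_measurable d (Omega : measurableType d) (R : realType)
    (G : R -> set (set Omega)) (X : R -> Omega -> R) (t : R) :
  filtration G -> adapted G X -> 0 <= t -> measurable_fun setT (X t).
Proof.
move=> [_ Gm _] aX t0 _ B mB.
have sub : <<s G t >> `<=` @measurable _ Omega.
  by apply: smallest_sub; [exact: sigma_algebra_measurable|exact: Gm].
by apply: sub; apply: (aX t t0).
Qed.

Lemma cylinder_coordinate (R : realType) (t : R) (B : set R) :
  0 <= t -> measurable B -> cylinder_sigma_algebra [set x : R -> R | B (x t)].
Proof. by move=> t0 mB; apply: sub_sigma_algebra; exists t, B. Qed.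

(** Tested against a bounded continuous function that vanishes at a and equals 1
    at b, the variables X_ k have expectation at least p, while the limit has
    expectation 0 unless a = b. *)
Lemma converges_in_law_cst_atom d (Omega : measurableType d) (R : realType)
    (P : probability Omega R) (X_ : nat -> Omega -> R) (a b p : R) :
  (forall k, measurable_fun setT (X_ k)) ->
  0 < p -> (\forall k \near \oo, (p%:E <= P (X_ k @^-1` [set b]))%E) ->
  converges_in_law P X_ (cst a) -> a = b.
Proof.
move=> mX p0 pX cX; apply: contrapT => /eqP ab.
have ab0 : 0 < `|b - a| by rewrite normr_gt0 subr_eq0 eq_sym.
(* The division by |b - a| makes f b equal to 1. *)
pose f (x : R) : R := Num.min 1 (`|x - a| / `|b - a|).
have f0 x : 0 <= f x by rewrite le_min ler01 divr_ge0.
have f1 x : f x <= 1 by rewrite ge_min lexx.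
have cf : continuous f.
  move=> x; apply: (@continuous_min R R (cst 1) (fun x => `|x - a| / `|b - a|)).
    exact: cvg_cst.
  apply: cvgM; last exact: cvg_cst.
  by apply: cvg_norm; apply: cvgB; [exact: cvg_id|exact: cvg_cst].
have bf : bounded_fun f.
  exists 1; split=> // M M1 x _ /=.
  by rewrite ger0_norm // (le_trans (f1 x)) // ltW.
have mf : measurable_fun setT f.
  exact: continuous_measurable_fun.
have /cvge_to_ge := cX f cf bf.
move=> /(_ p%:E) H; suff : (p%:E <= 'E_P[f \o cst a])%E.
  rewrite (_ : f \o cst a = cst 0); last first.
    by apply/funext => w; rewrite /f /= subrr normr0 mul0r; apply/min_idPr.
  by rewrite expectation_cst lee_fin leNgt p0.
apply: H; apply: filterS pX => k pk; apply: (le_trans pk).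
have mA : measurable (X_ k @^-1` [set b]).
  by rewrite -[X in measurable X]setTI; apply: mX.
rewrite -(expectation_indic P mA) unlock.
apply: ge0_le_integral => //.
- by apply/measurable_EFinP; exact: measurable_indic.
- by apply/measurable_EFinP; apply: measurableT_comp.
- move=> w _; rewrite lee_fin indicE.
  case: (boolP (w \in _)) => [|_]; last exact: f0.
  by rewrite inE /= /f => ->; rewrite divff ?gt_eqF// minxx.
Qed.

Lemma independent_processes_prod d (Omega : measurableType d) (R : realType)
    (P : probability Omega R) (Y : nat -> R -> Omega -> R) (n : nat)
    (C : nat -> set (R -> R)) (p : R) :
  independent_processes P Y ->
  (forall i, cylinder_sigma_algebra (C i)) ->
  (forall i, P (path_event (Y i) (C i)) = p%:E) ->
  P [set w | forall i : 'I_n, path_event (Y i) (C i) w] = (p ^+ n)%:E.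
Proof.
move=> iY cC pC.
pose J := seq_fset tt (iota 0 n).
have Jn i : (i \in J) = (i < n)%N by rewrite seq_fsetE mem_iota.
rewrite (_ : [set w | _] = \bigcap_(i in [set` J]) path_event (Y i) (C i)).
  rewrite iY // (eq_bigr (fun=> p%:E)) // (perm_big (iota 0 n)); last first.
    by rewrite -[X in perm_eq _ X]undup_id ?iota_uniq // seq_fset_perm.
  rewrite -[n in iota 0 n]subn0 -/(index_iota 0 n) prodEFin.
  by rewrite prodr_const_nat subn0.
apply/seteqP; split=> w /= H i.
- by rewrite /= Jn => ni; exact: (H (Ordinal ni)).
- by apply: H; rewrite /= Jn.
Qed.

(** Complementation maps the sets with fewer than n/2 elements injectively into
    those with at least n/2 elements, so the latter are at least half of all. *)
Lemma card_majority_sets (n : nat) :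
  (2 ^ n <= (#|[set S : {set 'I_n} | (n <= #|S|.*2)%N]%SET|).*2)%N.
Proof.
set A := finset _.
have cA : (#|A| + #|~: A| = 2 ^ n)%N.
  by rewrite cardsC -cardsT -powersetT card_powerset cardsT card_ord.
rewrite -cA -addnn leq_add2l -(card_imset (mem (~: A)%SET) (@finset.setC_inj _)).
apply: subset_leq_card; apply/fintype.subsetP => _ /imsetP[S SA ->].
move: SA; rewrite !inE -ltnNge => SA.
by have := cardsC S; rewrite card_ord; lia.
Qed.

(** The event fixes all n signals, not only the number of them equal to a: it is
    then a disjoint union of cells indexed by the set S of players with signal
    a, each of them of probability 2^-n for independent fair signals. *)
Definition majority_event (Omega R : Type) (X : nat -> Omega -> R) (a b : R)
    (n : nat) : set Omega :=
  [set w | exists2 S : {set 'I_n}, (n <= #|S|.*2)%N &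
     forall i : 'I_n, X i w = if i \in S then a else b].

(** The 2^n cells are equally likely, and by [card_majority_sets] at least half
    of them lie in the majority event. Measurability is part of the conclusion
    because monotonicity of P will be applied to this event. *)
Lemma half_le_prob_majority d (Omega : measurableType d) (R : realType)
    (P : probability Omega R) (Y : nat -> R -> {RV P >-> R}) (a b : R)
    (n : nat) :
  a != b -> independent_processes P (fun i t => Y i t) ->
  (forall i, P (Y i 0 @^-1` [set a]) = (2^-1)%:E) ->
  (forall i, P (Y i 0 @^-1` [set b]) = (2^-1)%:E) ->
  let M := majority_event (fun i => Y i 0) a b n in
  measurable M /\ ((2^-1)%:E <= P M)%E.
Proof.
move=> ab iY Pa Pb M.
pose E (S : {set 'I_n}) :=
  [set w | forall i : 'I_n, Y i 0 w = if i \in S then a else b].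
pose A := [set S : {set 'I_n} | (n <= #|S|.*2)%N]%SET.
have mE S : measurable (E S).
  rewrite (_ : E S = \bigcap_(i in [set: 'I_n])
    (Y i 0 @^-1` [set if i \in S then a else b])).
    apply: fin_bigcap_measurable => [|i _]; first exact: finite_finset.
    by rewrite -[X in measurable X]setTI; exact: measurable_funPT.
  by apply/seteqP; split=> w H i; [move=> _|]; exact: H.
have PE S : P (E S) = ((2^-1) ^+ n)%:E.
  (* v extends the prescribed signals of the n players to all indices, because
     independence is stated for a family of events indexed by nat. *)
  pose v k := if k \in [seq val i | i <- enum S] then a else b.
  have vE (i : 'I_n) : v i = if i \in S then a else b.
    by rewrite /v mem_map ?mem_enum //; exact: val_inj.
  rewrite -(independent_processes_prod (C := fun k => [set x | x 0 = v k])
    (p := 2^-1) n iY); last 2 first.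
  - by move=> k; apply: (@cylinder_coordinate _ 0 [set v k]).
  - by move=> k; rewrite /path_event /= /v; case: ifP => _; [exact: Pa|exact: Pb].
  by congr (P _); apply/seteqP; split=> w H i; have := H i;
    rewrite /path_event /= vE.
have -> : M = \bigcup_(S in [set` A]) E S.
  apply/seteqP; split=> w [S].
  - by move=> SA ES; exists S => //; rewrite /= inE.
  - by rewrite /= inE => SA ES; exists S.
split; first by apply: fin_bigcup_measurable.
rewrite measure_fin_bigcup //; last first.
  move=> S S' _ _ [w [/= ES ES']]; apply/setP => i.
  have := ES i; rewrite (ES' i).
  by case: ifP; case: ifP => // _ _ /eqP; rewrite ?(eq_sym b) (negbTE ab).
rewrite (_ : [set` A] = [set` enum A]); last first.
  by apply/seteqP; split=> S /=; rewrite mem_enum.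
rewrite -fsbig_seq ?enum_uniq // big_enum /=.
rewrite (eq_bigr (fun=> ((2^-1) ^+ n)%:E)); last by move=> S _; exact: PE.
rewrite sumEFin sumr_const lee_fin.
have := card_majority_sets n; rewrite -/A -(ler_nat R) natrX -muln2 natrM => H.
have p0 : 0 < 2 ^+ n :> R by rewrite exprn_gt0.
rewrite exprVn -[leRHS]mulr_natl ler_pdivlMr //; lra.
Qed.

(** The players in S stop at time 0 by their own signals. A player outside S then
    counts all of S among the others at time 0, a proportion of at least 1/2,
    which raises its own signal, also at least 1/2, to the threshold. *)
Lemma player_equilibrium_all_stopped d (Omega : measurableType d)
    (R : realType) (G : R -> set (set Omega)) (Y : nat -> R -> Omega -> R)
    (n : nat) (rho : R -> Omega -> R) (S : {set 'I_n}) (t : R) (w : Omega) :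
  player_equilibrium G Y 1 1 n rho -> (0 < n)%N -> (n <= #|S|.*2)%N ->
  (forall i : 'I_n, i \in S -> 1 <= Y i 0 w) ->
  (forall i : 'I_n, 2^-1 <= Y i 0 w) -> 0 <= t -> rho t w = 1.
Proof.
move=> [_ [tau [_ tauE rhoE]]] n0 nS YS Yhalf t0.
have n0R : 0 < n%:R :> R by rewrite ltr0n.
have stop0 (i : 'I_n) : 1 <= Y i 0 w + proportion_others_stopped tau i 0 w ->
    (tau i w <= 0%:E)%E.
  move=> H; rewrite tauE; apply: ereal_inf_lbound.
  by exists 0 => //; split; rewrite ?lexx ?mul1r.
have stopS i : i \in S -> (tau i w <= 0%:E)%E.
  move=> iS; apply: stop0; apply: (le_trans (YS i iS)).
  by rewrite lerDl divr_ge0.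
have stop i : (tau i w <= 0%:E)%E.
  have [/stopS //|iS] := boolP (i \in S).
  apply: stop0; have := Yhalf i.
  suff : 2^-1 <= proportion_others_stopped tau i 0 w by lra.
  rewrite /proportion_others_stopped ler_pdivlMr //.
  have : (#|S| <= #|[pred j | (j != i) && (tau j w <= 0%:E)%E]|)%N.
    apply: subset_leq_card; apply/fintype.subsetP => j jS.
    by rewrite !inE stopS // andbT; apply: contraNneq iS => <-.
  rewrite -(ler_nat R); move: nS; rewrite -(ler_nat R) -muln2 natrM; lra.
rewrite rhoE // /proportion_stopped (@eq_card _ _ predT).
  by rewrite cardT size_enum_ord divff // gt_eqF.
by move=> j; rewrite !inE (le_trans (stop j)) // lee_fin.
Qed.

Theorem corollary5p9 (R : realType) (d : measure_display)
    (Omega : measurableType d) (P : probability Omega R)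
    (G : R -> set (set Omega)) (Y : nat -> R -> {RV P >-> R}) (T : R)
    (hG : filtration G) (hGr : right_continuous_filtration G)
    (hYG : forall i, progressively_measurable G (fun t => Y i t))
    (hT : 0 < T)
    (hiid : iid_processes P (fun i t => Y i t))
    (hYconst : forall i (t : R) w, 0 <= t < T -> Y i t w = Y i 0 w)
    (hYlaw : forall i (t : R) (B : set R), 0 <= t < T -> measurable B ->
       distribution P (Y i t) B =
         ((2^-1 : R)%R%:E * \d_(2^-1 : R)%R B + (2^-1 : R)%R%:E * \d_(2 : R)%R B)%E)
    (hYlate : forall i (t : R) w, T <= t -> Y i t w = 2)
    (t : R) (ht : 0 <= t < T) :
  [/\ minimal_solution 1 1 (Y 0%N t) (rho_min 1 1 Y t),
      rho_min 1 1 Y t = 2^-1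
    & ~ weak_accumulation_point_of_equilibria P G (fun i s => Y i s)
          1 1 t (rho_min 1 1 Y t)].
Proof.
have cdfE u : 0 <= u <= 1 ->
    cdf (Y 0%N t) (1 - 1 * u) = (if u <= 2^-1 then 2^-1 else 0)%:E.
  move=> u01; rewrite /cdf hYlaw // !diracE !mem_setE !in_itv /= mul1r.
  rewrite (_ : (2 <= 1 - u) = false) ?mule0 ?adde0; last by apply/negbTE; lra.
  by case: ifPn => hu; [rewrite (_ : 2^-1 <= 1 - u) ?mule1 //; lra|
    rewrite (_ : (2^-1 <= 1 - u) = false) ?mule0 //; apply/negbTE; lra].
have min_half : minimal_solution 1 1 (Y 0%N t) 2^-1.
  split.
    have h01 : 0 <= (2^-1 : R) <= 1 by lra.
    split=> //; rewrite cdfE // lexx -EFinD; congr _%:E; lra.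
  move=> v [v01]; rewrite cdfE // -EFinD => -[].
  by case: ifPn; lra.
have rhoE : rho_min 1 1 Y t = 2^-1.
  apply: (xget_subset1 _ min_half) => u v [su mu] [sv mv].
  by apply/eqP; rewrite eq_le mu // mv.
rewrite rhoE; split=> // -[n_ [rho_ [n_oo eq_rho cvg_rho]]].
have t0 : 0 <= t by case/andP: ht.
have h0T : 0 <= (0 : R) < T by rewrite lexx.
have P2 i : P (Y i 0 @^-1` [set 2]) = (2^-1)%:E.
  have := hYlaw i 0 [set 2] h0T (measurable_set1 _).
  rewrite /distribution /pushforward => ->; rewrite !diracE !classical_sets.in_set1.
  rewrite [2^-1 == 2](_ : _ = false) ?eqxx ?mule0 ?mule1 ?add0e //.
  by apply/negbTE/eqP; lra.
have Phalf i : P (Y i 0 @^-1` [set 2^-1]) = (2^-1)%:E.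
  have := hYlaw i 0 [set 2^-1] h0T (measurable_set1 _).
  rewrite /distribution /pushforward => ->; rewrite !diracE !classical_sets.in_set1.
  rewrite [2 == 2^-1](_ : _ = false) ?eqxx ?mule0 ?mule1 ?adde0 //.
  by apply/negbTE/eqP; lra.
have mrho k : measurable_fun setT (rho_ k t).
  by have [ark _] := eq_rho k; exact: adapted_measurable hG ark t0.
suff /eqP : 2^-1 = 1 :> R by lra.
apply: (converges_in_law_cst_atom (p := 2^-1) mrho) cvg_rho; first by lra.
have : \forall k \near \oo, (0 < n_ k)%N by exact: n_oo (nbhs_infty_gt 0).
apply: filterS => k nk0.
have two_neq_half : 2 != 2^-1 :> R by apply/eqP; lra.
have [indY _] := hiid.
have [mM PM] := half_le_prob_majority (n_ k) two_neq_half indY P2 Phalf.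
apply: (le_trans PM); apply: le_measure; rewrite ?inE //.
  by rewrite -[X in measurable X]setTI; exact: mrho.
move=> w [S nS YS].
apply: (player_equilibrium_all_stopped (eq_rho k) nk0 nS) => // i.
- by move=> iS; rewrite YS iS; lra.
- by rewrite YS; case: ifP => _; lra.
Qed.
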